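(* Let $n < m$ be positive integers and let $\beta, \eta$ satisfy $1/m \le \beta, \eta < 1/8$; put $\alpha = \beta + 2\eta$. There is an algorithm with preprocessing for $\mathsf{BNCP}_{\beta,\eta}$ (on codes of message length $n$ and blocklength $m$) whose advice size and running time are both $$\frac{m^4 \log^2(1/\alpha)}{n^2}\cdot \exp\!\left[O\!\left(\frac{\eta n}{\log(1/\alpha)}\right)\right].$$
   Context: All vectors are over $\mathbb{F}_2$. A linear code is given by a full-rank generator matrix $C \in \mathbb{F}_2^{m\times n}$ with $m>n$; the code is $\mathcal{C} = \{Cx : x \in \mathbb{F}_2^n\}$ ($n$ is the message length, $m$ the blocklength). $\mathrm{wt}(v)$ is the Hamming weight and $\mathrm{dist}(\mathcal{C},w) = \min_{v\in\mathcal{C}} \mathrm{wt}(v+w)$. A vector $w\in\mathbb{F}_2^m$ is $\beta$-balanced if $\mathrm{wt}(w) \in [\tfrac12(1-\beta)m, \tfrac12(1+\beta)m]$; the code $\mathcal{C}$ is $\beta$-balanced if every nonzero codeword is $\beta$-balanced. The (search) balanced nearest codeword problem $\mathsf{BNCP}_{\beta,\eta}$: given $(C,w)$ with $C\in\mathbb{F}_2^{m\times n}$, $w\in\mathbb{F}_2^m$, under the promise that $\mathcal{C}$ is $\beta$-balanced and $\mathrm{dist}(\mathcal{C},w) < \eta m$, output some $x\in\arg\min_{x\in\mathbb{F}_2^n}\mathrm{wt}(Cx+w)$. An algorithm with preprocessing consists of an advice function assigning to each generator matrix $C$ an advice string (depending only on $C$, not on $w$, and not required to be efficiently computable), together with an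 online algorithm that receives $(C,w)$ and the advice for $C$ and must answer correctly on every instance satisfying the promise. The advice size is the length of the advice string and the running time is that of the online algorithm. $\log$ denotes the base-2 logarithm; $\exp[O(f)]$ means $\exp(c f)$ for some absolute constant $c$. *)

(* Defs.v *)
From mathcomp Require Import all_boot all_order all_algebra.
From mathcomp Require Import reals sequences exp.

Set Implicit Arguments.
Unset Strict Implicit.
Unset Printing Implicit Defensive.

Import Order.TTheory GRing.Theory Num.Theory.

Local Open Scope ring_scope.

Section Codes.
Variables m n : nat.

Definition wt (v : 'cV['F_2]_m) : nat := #|[set i | v i 0 != 0]|.

Definition generator_matrix (C : 'M['F_2]_(m, n)) : Prop := \rank C = n.

Definition code (C : 'M['F_2]_(m, n)) : {set 'cV['F_2]_m} :=
  [set C *m x | x : 'cV['F_2]_n].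

(* The unit [m] of the iterated minimum is harmless: weights are at most [m]
   and [code C] is nonempty. *)
Definition dist (A : {set 'cV['F_2]_m}) (w : 'cV['F_2]_m) : nat :=
  \big[minn/m]_(v in A) wt (v + w).

Definition nearest (C : 'M['F_2]_(m, n)) (w : 'cV['F_2]_m)
    (x : 'cV['F_2]_n) : Prop :=
  forall y : 'cV['F_2]_n, (wt (C *m x + w)%R <= wt (C *m y + w)%R)%N.

Variable R : realType.

Definition balanced (beta : R) (w : 'cV['F_2]_m) : Prop :=
  2^-1 * (1 - beta) * m%:R <= (wt w)%:R <= 2^-1 * (1 + beta) * m%:R.

Definition balanced_code (beta : R) (A : {set 'cV['F_2]_m}) : Prop :=
  forall v, v \in A -> v != 0 -> balanced beta v.

Definition BNCP_promise (beta eta : R)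
    (C : 'M['F_2]_(m, n)) (w : 'cV['F_2]_m) : Prop :=
  balanced_code beta (code C) /\ (dist (code C) w)%:R < eta * m%:R.

End Codes.

(* A unit-cost RAM whose only arithmetic is successor and predecessor. After
   [t] steps no register or memory cell exceeds the largest initial value or
   program constant by more than [t], so unit cost hides no arithmetic on long
   integers, and one step is O(1) steps of any customary RAM or word RAM. *)
Inductive instr : Type :=
| Const of nat & nat
| Move of nat & nat
| Succ of nat
| Pred of nat
| Read of nat & nat
| Write of nat & nat
| JumpLe of nat & nat & nat.

Definition program := seq instr.

Record config : Type := Config {
  pc : nat;
  regs : nat -> nat;
  memory : nat -> nat
}.

Definition update (f : nat -> nat) (a b : nat) : nat -> nat :=
  fun x => if x == a then b else f x.

Definition exec (i : instr) (s : config) : config :=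
  let: Config p g h := s in
  match i with
  | Const r k => Config p.+1 (update g r k) h
  | Move r q => Config p.+1 (update g r (g q)) h
  | Succ r => Config p.+1 (update g r (g r).+1) h
  | Pred r => Config p.+1 (update g r (g r).-1) h
  | Read r q => Config p.+1 (update g r (h (g q))) h
  | Write r q => Config p.+1 g (update h (g r) (g q))
  | JumpLe r q l => Config (if (g r <= g q)%N then l else p.+1) g h
  end.

(* The machine halts by moving the program counter outside the program. *)
Definition halted (P : program) (s : config) : bool := (size P <= pc s)%N.

Definition step (P : program) (s : config) : config :=
  if onth P (pc s) is Some i then exec i s else s.

Definition run (P : program) (t : nat) (s : config) : config :=
  iter t (step P) s.

Section Preprocessing.
Variables m n : nat.

(* Row-major [C], then [w], then the advice, one bit per memory cell. *)
Definition input_bits (C : 'M['F_2]_(m, n)) (w : 'cV['F_2]_m)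
    (a : seq bool) : seq bool :=
  [seq C i j != 0 | i <- enum 'I_m, j <- enum 'I_n]
    ++ [seq w i 0 != 0 | i <- enum 'I_m] ++ a.

Definition init (C : 'M['F_2]_(m, n)) (w : 'cV['F_2]_m) (a : seq bool) :
    config :=
  Config 0 (nth 0%N [:: n; m; size a])
    (fun p => nat_of_bool (nth false (input_bits C w a) p)).

(* The answer is read off the first [n] memory cells. *)
Definition outputs (s : config) (x : 'cV['F_2]_n) : Prop :=
  forall i : 'I_n, memory s i = nat_of_bool (x i 0 != 0).

Definition advice_function := 'M['F_2]_(m, n) -> seq bool.

Variable R : realType.

Definition solves_BNCP (beta eta : R) (adv : advice_function) (P : program) :
    Prop :=
  forall (C : 'M['F_2]_(m, n)) (w : 'cV['F_2]_m),
    generator_matrix C -> BNCP_promise beta eta C w ->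
    exists t x, [/\ halted P (run P t (init C w (adv C))),
                    outputs (run P t (init C w (adv C))) x
                  & nearest C w x].

Definition advice_size_le (adv : advice_function) (b : R) : Prop :=
  forall C : 'M['F_2]_(m, n), generator_matrix C -> (size (adv C))%:R <= b.

(* Worst case over all inputs, including those violating the promise. *)
Definition running_time_le (adv : advice_function) (P : program) (b : R) :
    Prop :=
  forall (C : 'M['F_2]_(m, n)) (w : 'cV['F_2]_m), generator_matrix C ->
    exists t : nat, t%:R <= b /\ halted P (run P t (init C w (adv C))).

End Preprocessing.

Definition log2 (R : realType) (x : R) : R := ln x / ln 2.

Definition bound (R : realType) (c : R) (n m : nat) (beta eta : R) : R :=
  let alpha := beta + 2 * eta in
  m%:R ^+ 4 * log2 (1 / alpha) ^+ 2 / n%:R ^+ 2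
    * expR (c * (eta * n%:R / log2 (1 / alpha))).

(* Main.v *)
Require Import Defs.
From mathcomp Require Import all_boot all_order all_algebra.
From mathcomp Require Import boolp reals sequences exp.
From mathcomp Require Import zify ring lra.

(* Let [alpha = beta + 2 eta] and let [t] be about [64 n / log2 (1 / alpha)].
   Draw a random sequence of [t] row indices of [C], conditioned on the rows
   summing to 0.  It is a parity check [h]: [<h, w> = <h, e>] for the error [e]
   of a word [w].  Expanding the condition over the characters of [F_2^n], the
   zero codeword contributes about [(1 - 2 eta)^t] to the expectation of
   [(-1)^<h, e>], while every other codeword contributes at most about
   [alpha^t], and [2^n alpha^t] is negligible.  Restricted to the checks that
   visit coordinate [j] exactly once, an event of probability about [t / m], the
   same expansion shows that [(-1)^<h, e>] has a bias of sign [(-1)^(e_j)] and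
   of size at least of order [(t / m) (1 - 3 eta)^t].  By a Chernoff bound and a
   union bound over all pairs [(e, j)], some
   [N = O(m (m / t)^2 (1 - 3 eta)^(-2 t))] checks decide every bit of every
   low-weight error by a majority vote.  The advice consists of these checks, of
   the coordinates that each visits exactly once, and of a left inverse of [C];
   the online algorithm reads it once. *)

Set Implicit Arguments.
Unset Strict Implicit.
Unset Printing Implicit Defensive.

Import Order.TTheory GRing.Theory Num.Theory.

Local Open Scope nat_scope.

(** * The machine *)

(* Registers 0, 1 and 3 hold [n], [m] and 0.  From instruction 15 on,
   registers 7, 6 and 5 hold the addresses of [w] and of two arrays of [m]
   counters, the votes for [e_p = 0] and for [e_p = 1], and register 4 scans the
   advice.  Swapping registers 12 and 13 records a parity. *)
Definition decoder : program := [::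
  (*  0 *) Move 9 0; Succ 9; Succ 9; Succ 9;
  (*  4 *) JumpLe 9 8 15;
  (*  5 *) Move 7 6; Move 6 5; Move 5 4; Const 10 0;
  (*  9 *) JumpLe 1 10 13;
  (* 10 *) Succ 4; Succ 10; JumpLe 3 3 9;
  (* 13 *) Succ 8; JumpLe 3 3 4;
  (* 15 *) Read 11 4; Succ 4; JumpLe 11 3 45;
  (* 18 *) Move 12 6; Move 13 5; Move 14 7; Const 10 0;
  (* 22 *) JumpLe 1 10 34;
  (* 23 *) Read 11 4; Read 15 14; Succ 4; Succ 14; Succ 10;
  (* 28 *) JumpLe 11 3 22; JumpLe 15 3 22;
  (* 30 *) Move 16 12; Move 12 13; Move 13 16; JumpLe 3 3 22;
  (* 34 *) Const 10 0;
  (* 35 *) JumpLe 1 10 15;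
  (* 36 *) Read 11 4; Succ 4; Succ 10; JumpLe 11 3 43;
  (* 40 *) Read 15 12; Succ 15; Write 12 15;
  (* 43 *) Succ 12; JumpLe 3 3 35;
  (* 45 *) Move 12 6; Move 13 5; Move 14 7; Const 10 0;
  (* 49 *) JumpLe 1 10 64;
  (* 50 *) Read 11 12; Read 15 13; Succ 12; Succ 13; Succ 10;
  (* 55 *) JumpLe 15 11 62; Read 11 14; Const 15 1;
  (* 58 *) JumpLe 11 3 61; Write 14 3; JumpLe 3 3 62;
  (* 61 *) Write 14 15;
  (* 62 *) Succ 14; JumpLe 3 3 49;
  (* 64 *) Const 8 0;
  (* 65 *) JumpLe 0 8 85;
  (* 66 *) Const 12 0; Const 13 1; Move 14 7; Const 10 0;
  (* 70 *) JumpLe 1 10 82;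
  (* 71 *) Read 11 4; Read 15 14; Succ 4; Succ 14; Succ 10;
  (* 76 *) JumpLe 11 3 70; JumpLe 15 3 70;
  (* 78 *) Move 16 12; Move 12 13; Move 13 16; JumpLe 3 3 70;
  (* 82 *) Write 8 12; Succ 8; JumpLe 3 3 65 ].

(* Registers as a list, so that execution of the decoder computes. *)
Definition lconfig : Type := (nat * seq nat * (nat -> nat))%type.

Definition of_lconfig (s : lconfig) : config :=
  Config s.1.1 (nth 0 s.1.2) s.2.

Definition lexec (i : instr) (s : lconfig) : lconfig :=
  let: (p, l, h) := s in
  match i with
  | Const r k => (p.+1, set_nth 0 l r k, h)
  | Move r q => (p.+1, set_nth 0 l r (nth 0 l q), h)
  | Succ r => (p.+1, set_nth 0 l r (nth 0 l r).+1, h)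
  | Pred r => (p.+1, set_nth 0 l r (nth 0 l r).-1, h)
  | Read r q => (p.+1, set_nth 0 l r (h (nth 0 l q)), h)
  | Write r q => (p.+1, l, update h (nth 0 l r) (nth 0 l q))
  | JumpLe r q k => (if nth 0 l r <= nth 0 l q then k else p.+1, l, h)
  end.

Definition lstep (P : program) (s : lconfig) : lconfig :=
  if onth P s.1.1 is Some i then lexec i s else s.

Lemma step_of_lconfig P s : step P (of_lconfig s) = of_lconfig (lstep P s).
Proof.
case: s => [[p l] h]; rewrite /step /lstep /=.
case: (onth P p) => // i.
have upd r v : update (nth 0 l) r v = nth 0 (set_nth 0 l r v).
  by apply/funext=> x; rewrite nth_set_nth.
by case: i => * /=; rewrite /of_lconfig /= ?upd.
Qed.

(** An upper bound on the steps rather than an exact count, so that branches of different lengths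
    share one bound. *)
Definition reach (s s' : lconfig) (k : nat) :=
  exists2 t, t <= k & iter t (lstep decoder) s = s'.

Lemma reach_run s s' k : reach s s' k ->
  exists2 t, t <= k & run decoder t (of_lconfig s) = of_lconfig s'.
Proof.
case=> t tk <-; exists t => //; rewrite /run.
by elim: t {tk} => //= t ->; rewrite step_of_lconfig.
Qed.

Lemma reach_refl s k : reach s s k.
Proof. by exists 0. Qed.

Lemma reach_step s s' k : reach (lstep decoder s) s' k -> reach s s' k.+1.
Proof. by case=> t tk e; exists t.+1 => //; rewrite iterSr. Qed.

Lemma reach_trans s2 k1 s1 s3 k2 :
  reach s1 s2 k1 -> reach s2 s3 k2 -> reach s1 s3 (k1 + k2).
Proof.
case=> t1 tk1 e1 [t2 tk2 e2]; exists (t2 + t1); first by lia.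
by rewrite iterD e1.
Qed.

Lemma reach_le k1 s s' k2 : k1 <= k2 -> reach s s' k1 -> reach s s' k2.
Proof. by move=> k12 [t tk e]; exists t => //; lia. Qed.

Ltac run1 := apply: reach_step; rewrite /lstep /=.
Ltac stop := exact: reach_refl.

(** * Execution of the decoder, loop by loop *)

Section Decoder.
Variables n m : nat.

Lemma advance_loop k r2 p r5 r6 r7 r8 r9 r11 r12 r13 r14 r15 r16 h : k <= m ->
  reach (9, [:: n; m; r2; 0; p; r5; r6; r7; r8; r9; 0; r11; r12; r13; r14; r15; r16], h)
    (9, [:: n; m; r2; 0; p + k; r5; r6; r7; r8; r9; k; r11; r12; r13; r14; r15; r16], h)
    (4 * k).
Proof.
elim: k => [|k IH] km; first by rewrite addn0; stop.
rewrite mulnSr; apply: reach_trans (IH (ltnW km)) _.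
run1; rewrite leqNgt km /=; do 3 run1; rewrite -addnS; stop.
Qed.

(** Multiples of [m] arise without multiplication: registers 5, 6 and 7 are copies of register 4
    delayed by one, two and three rounds, so [n + 3] rounds leave [n * m] to [(n + 3) * m] in
    registers 7, 6, 5 and 4. *)
Lemma layout_loop k r2 r11 r12 r13 r14 r15 r16 h : 3 <= k -> k <= n + 3 ->
  exists r10,
  reach (0, [:: n; m; r2; 0; 0; 0; 0; 0; 0; 0; 0; r11; r12; r13; r14; r15; r16], h)
    (4, [:: n; m; r2; 0; k * m; k.-1 * m; (k - 2) * m; (k - 3) * m; k; n + 3;
        r10; r11; r12; r13; r14; r15; r16], h)
    (4 + k * (4 * m + 8)).
Proof.
move=> k3 kn.
(* The delayed copies stay abstract until they are filled, so that the induction can start at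
   [k = 0]. *)
suff [r5 [r6 [r7 [r10 [re e1 e2 e3]]]]] : exists r5 r6 r7 r10,
  [/\ reach (0, [:: n; m; r2; 0; 0; 0; 0; 0; 0; 0; 0; r11; r12; r13; r14; r15; r16], h)
    (4, [:: n; m; r2; 0; k * m; r5; r6; r7; k; n + 3; r10; r11; r12; r13; r14; r15; r16], h)
    (4 + k * (4 * m + 8)),
    0 < k -> r5 = k.-1 * m, 1 < k -> r6 = (k - 2) * m & 2 < k -> r7 = (k - 3) * m].
  by exists r10; rewrite -e1 -?e2 -?e3 //; lia.
elim: k {k3} kn => [|k IH] kn.
  exists 0, 0, 0, 0; split => //; do 4 run1.
  by rewrite -(addn3 n); stop.
have [r5 [r6 [r7 [r10 [re e1 e2 e3]]]]] := IH (ltnW kn).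
exists (k * m), r5, r6, m; split=> //.
- rewrite [k.+1 * (_ + _)]mulSnr addnA; apply: (reach_trans re).
  apply: (@reach_le (4 * m + 3).+4.+1); first by lia.
  run1; rewrite leqNgt kn /=; do 4 run1.
  apply: reach_trans (advance_loop _ _ _ _ _ _ _ _ _ _ _ _ _ _ (leqnn m)) _.
  run1; rewrite leqnn; do 2 run1; rewrite mulSnr; stop.
- by move=> ?; rewrite e1 ?subn2 //; lia.
Qed.

(** Its parity is the inner product over [F_2] of the bits stored at [q] and at [a]. *)
Definition hits (h : nat -> nat) q a k :=
  \sum_(p < k) ((0 < h (q + p)) && (0 < h (a + p))).

(** Each common 1 swaps registers 12 and 13. The program contains this loop twice: at 22 it selects
    a counter array; at 70, started on 0 and 1, it leaves the parity itself in register 12. *)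
Lemma parity_loop b k r2 q r5 r6 r7 r8 r9 r11 x y a r15 r16 h :
    b = 22 \/ b = 70 -> k <= m ->
  exists r11' r15' r16',
  reach (b, [:: n; m; r2; 0; q; r5; r6; r7; r8; r9; 0; r11; x; y; a; r15; r16], h)
    (b, [:: n; m; r2; 0; q + k; r5; r6; r7; r8; r9; k; r11';
        if odd (hits h q a k) then y else x; if odd (hits h q a k) then x else y;
        a + k; r15'; r16'], h)
    (12 * k).
Proof.
move=> hb; elim: k => [|k IH] km.
  by exists r11, r15, r16; rewrite /hits big_ord0 !addn0; stop.
have {IH}[s11 [s15 [s16 IH]]] := IH (ltnW km).
have -> : hits h q a k.+1 =
    hits h q a k + ((0 < h (q + k)) && (0 < h (a + k))) by rewrite /hits big_ord_recr.
set o := odd _ in IH.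
rewrite oddD -/o oddb !addnS mulnSr.
case hq: (h (q + k)) => [|c].
  exists 0, (h (a + k)), s16; rewrite addbF; apply: (reach_trans IH).
  case: hb => -> ; run1; rewrite leqNgt km /=; do 6 run1; rewrite hq /=; stop.
case ha: (h (a + k)) => [|d].
  exists c.+1, 0, s16; rewrite addbF; apply: (reach_trans IH).
  case: hb => ->; run1; rewrite leqNgt km /=; do 6 run1; rewrite hq /=; run1;
    rewrite ha /=; stop.
exists c.+1, d.+1, (if o then y else x); rewrite addbT !if_neg; apply: (reach_trans IH).
case: hb => ->; run1; rewrite leqNgt km /=; do 6 run1; rewrite hq /=; run1;
  rewrite ha /=; do 4 run1; stop.
Qed.

Definition count_row (h : nat -> nat) c q k : nat -> nat :=
  fun a => if c <= a < c + k then h a + (0 < h (q + (a - c))) else h a.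

Lemma count_rowS h c q k : c + k < q ->
  count_row h c q k.+1 = if 0 < h (q + k) then update (count_row h c q k) (c + k) (h (c + k)).+1
                    else count_row h c q k.
Proof.
move=> ckq; apply/funext=> a.
have -> : (if 0 < h (q + k) then update (count_row h c q k) (c + k) (h (c + k)).+1
   else count_row h c q k) a =
   if a == c + k then h (c + k) + (0 < h (q + k)) else count_row h c q k a.
  rewrite /update; case: (0 < _); case: (eqVneq a (c + k)) => [ea|//]; rewrite ?addn1 //.
  by rewrite ea /count_row ltnn andbF addn0.
rewrite /count_row; case: (eqVneq a (c + k)) => [->|ne].
  by rewrite leq_addr addnS ltnSn /= addKn.
by rewrite addnS ltnS [a <= c + k]leq_eqVlt (negbTE ne).
Qed.

(** The counters lie below [q], so the increments never touch the vote bits still to be read. *)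
Lemma count_loop k r2 q r5 r6 r7 r8 r9 r11 c r13 r14 r15 r16 h :
    k <= m -> c + m <= q ->
  exists r11' r15',
  reach (35, [:: n; m; r2; 0; q; r5; r6; r7; r8; r9; 0; r11; c; r13; r14; r15; r16], h)
    (35, [:: n; m; r2; 0; q + k; r5; r6; r7; r8; r9; k; r11'; c + k; r13; r14; r15'; r16],
     count_row h c q k)
    (10 * k).
Proof.
move=> km cq; elim: k km => [|k IH] km.
  exists r11, r15; rewrite !addn0; have -> : count_row h c q 0 = h.
    by apply/funext=> a; rewrite /count_row addn0; case: ifP => // /andP[]; lia.
  stop.
have {IH}[s11 [s15 IH]] := IH (ltnW km).
have bq : count_row h c q k (q + k) = h (q + k).
  by rewrite /count_row ifF //; apply/negbTE/negP => /andP[]; lia.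
have bc : count_row h c q k (c + k) = h (c + k) by rewrite /count_row ltnn andbF.
rewrite count_rowS; last by lia.
rewrite !addnS mulnSr.
case hq: (h (q + k)) => [|d].
  exists 0, s15; apply: (reach_trans IH).
  run1; rewrite leqNgt km /=; do 4 run1; rewrite bq hq /=; do 2 run1; stop.
exists d.+1, (h (c + k)).+1; apply: (reach_trans IH).
run1; rewrite leqNgt km /=; do 4 run1; rewrite bq hq /=; do 5 run1; rewrite bc; stop.
Qed.

Lemma eq_hits h h' q a k :
    (forall p, p < k -> h (q + p) = h' (q + p) /\ h (a + p) = h' (a + p)) ->
  hits h q a k = hits h' q a k.
Proof. by move=> hh; apply: eq_bigr => -[p pk] _ /=; have [-> ->] := hh p pk. Qed.

(** A sample occupies [2 * m + 1] cells: its mark, the [m] bits of its check, its [m] vote bits.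
    Hence the offsets [1] and [1 + m]. *)
Definition votes (h : nat -> nat) (o : bool) q a p N :=
  \sum_(i < N) ((odd (hits h (q + i * (2 * m + 1) + 1) a m) == o) &&
                (0 < h (q + i * (2 * m + 1) + 1 + m + p))).

Lemma sample_loop N i r2 q b a r8 r9 r10 r11 r12 r13 r14 r15 r16 h :
    i <= N -> a + m <= b -> q = b + 2 * m ->
    (forall j, j < N -> 0 < h (q + j * (2 * m + 1))) ->
  exists s10 s11 s12 s13 s14 s15 s16 h',
  [/\ reach (15, [:: n; m; r2; 0; q; b + m; b; a; r8; r9; r10; r11; r12; r13; r14; r15; r16], h)
       (15, [:: n; m; r2; 0; q + i * (2 * m + 1); b + m; b; a; r8; r9;
           s10; s11; s12; s13; s14; s15; s16], h')
       (i * (22 * m + 10)),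
     forall x, (x < b) || (q <= x) -> h' x = h x,
     forall p, p < m -> h' (b + p) = h (b + p) + votes h false q a p i
   & forall p, p < m -> h' (b + m + p) = h (b + m + p) + votes h true q a p i].
Proof.
move=> iN ab eq hN; elim: i iN => [|i IH] iN.
  exists r10, r11, r12, r13, r14, r15, r16, h.
  by rewrite /votes addn0 mul0n; split=> [|//|p|p]; rewrite ?big_ord0 ?addn0 //; stop.
have [s10 [s11 [s12 [s13 [s14 [s15 [s16 [h' [IHr hout h0 h1]]]]]]]]] := IH (ltnW iN).
set Q := q + i * (2 * m + 1) in IHr.
have [t11 [t15 [t16 par]]] := @parity_loop 22 m r2 Q.+1 (b + m) b a r8 r9 (h' Q) b
  (b + m) a s15 s16 h' (or_introl erefl) (leqnn m).
have eh : hits h' Q.+1 a m = hits h (Q + 1) a m.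
  rewrite addn1; apply: eq_hits => p pm.
  by split; apply: hout; rewrite /Q; lia.
rewrite {}eh in par; set o := odd _ in par.
(* The counter array selected by the parity of the check. *)
set c := (if o then b + m else b) in par.
have cq : c + m <= Q.+1 + m by rewrite /c /Q; case: ifP; lia.
have [u11 [u15 cnt]] := @count_loop m r2 (Q.+1 + m) (b + m) b a r8 r9 t11 c
  (if o then b else b + m) (a + m) t15 t16 h' (leqnn m) cq.
have flag1 : 0 < h' Q by rewrite hout; [exact: hN|rewrite /Q; lia].
exists m, u11, (c + m), (if o then b else b + m), (a + m), u15, t16,
  (count_row h' c (Q.+1 + m) m).
have count_rowE x : count_row h' c (Q.+1 + m) m x =
    h' x + ((c <= x < c + m) && (0 < h (Q + 1 + m + (x - c)))).
  rewrite /count_row; case: ifP => [xc|_]; last by rewrite addn0.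
  rewrite addn1 [h' (Q.+1 + _ + _)]hout //.
  by rewrite /Q; lia.
split.
- rewrite (_ : i.+1 * (22 * m + 10) =
    i * (22 * m + 10) + (12 * m + (10 * m + 1).+2).+4.+3); last by lia.
  apply: (reach_trans IHr).
  do 3 run1; rewrite leqNgt flag1 /=; do 4 run1.
  apply: (reach_trans par).
  run1; rewrite leqnn; run1; apply: (reach_trans cnt).
  run1; rewrite leqnn (_ : q + _ = Q.+1 + m + m); last by rewrite /Q; lia.
  stop.
- move=> x xb; rewrite count_rowE hout // (_ : _ && _ = false) ?addn0 //.
  by apply/negbTE/negP => /andP[/andP[]]; rewrite /c; case: ifP; lia.
- move=> p pm; rewrite count_rowE h0 // -addnA; congr (_ + _).
  rewrite /votes big_ord_recr /= -/Q -/o; congr (_ + nat_of_bool _).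
  rewrite /c; case: (o) => /=; last by rewrite leq_addr ltn_add2l pm addKn.
  by rewrite leq_add2l leqNgt pm.
- move=> p pm; rewrite count_rowE h1 // -[in LHS]addnA; congr (_ + _).
  rewrite /votes big_ord_recr /= -/Q -/o; congr (_ + nat_of_bool _).
  rewrite /c; case: (o) => /=; first by rewrite leq_addr ltn_add2l pm addKn.
  by rewrite (_ : b + m + p < b + m = false) ?andbF //; lia.
Qed.

(** A tie leaves the bit unchanged; [h x == 0], read as a number, is its complement. *)
Definition flip_word (h : nat -> nat) a b k : nat -> nat :=
  fun x => if a <= x < a + k then
             if h (b + m + (x - a)) <= h (b + (x - a)) then h x else h x == 0
           else h x.

Lemma flip_loop k r2 q b a r8 r9 r11 r15 r16 h : k <= m -> a + m <= b ->
  exists s11 s15,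
  reach (49, [:: n; m; r2; 0; q; b + m; b; a; r8; r9; 0; r11; b; b + m; a; r15; r16], h)
    (49, [:: n; m; r2; 0; q; b + m; b; a; r8; r9; k; s11; b + k; b + m + k; a + k; s15; r16],
     flip_word h a b k)
    (14 * k).
Proof.
move=> km ab; elim: k km => [|k IH] km.
  exists r11, r15; rewrite !addn0; have -> : flip_word h a b 0 = h.
    by apply/funext=> x; rewrite /flip_word addn0; case: ifP => // /andP[]; lia.
  stop.
have {IH}[s11 [s15 IH]] := IH (ltnW km).
have fb x : b <= x -> flip_word h a b k x = h x.
  by move=> bx; rewrite /flip_word ifF //; apply/negbTE/negP => /andP[]; lia.
have fa : flip_word h a b k (a + k) = h (a + k) by rewrite /flip_word ltnn andbF.
have fS : flip_word h a b k.+1 = update (flip_word h a b k) (a + k)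
    (if h (b + m + k) <= h (b + k) then h (a + k) else h (a + k) == 0).
  apply/funext=> x; rewrite /update /flip_word; case: (eqVneq x (a + k)) => [->|ne].
    by rewrite leq_addr addnS ltnSn /= addKn.
  by rewrite addnS ltnS [x <= a + k]leq_eqVlt (negbTE ne).
(* Without a flip the machine writes nothing, whereas [fS] speaks of an update. *)
have upd_id (g : nat -> nat) x : update g x (g x) = g.
  by apply/funext=> y; rewrite /update; case: eqP => [->|].
rewrite fS !addnS mulnSr; case: (leqP (h (b + m + k)) (h (b + k))) => hb.
  exists (h (b + k)), (h (b + m + k)); apply: (reach_trans IH).
  run1; rewrite leqNgt km /=; do 6 run1; rewrite !fb ?hb; try lia.
  do 2 run1; rewrite -fa upd_id; stop.
case ha: (h (a + k)) => [|d].
  exists 0, 1; apply: (reach_trans IH).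
  run1; rewrite leqNgt km /=; do 6 run1; rewrite !fb; try lia.
  rewrite leqNgt hb /=.
  do 3 run1; rewrite fa ha /=; do 3 run1; stop.
exists d.+1, 1; apply: (reach_trans IH).
run1; rewrite leqNgt km /=; do 6 run1; rewrite !fb; try lia.
  rewrite leqNgt hb /=.
do 3 run1; rewrite fa ha /=; do 4 run1; stop.
Qed.

Definition write_rows (h : nat -> nat) q a k : nat -> nat :=
  fun x => if x < k then odd (hits h (q + x * m) a m) : nat else h x.

(** The answer overwrites the lowest cells; [n <= a] and [a + m <= q] keep it away from the
    corrected word and from the rows still to be read. *)
Lemma output_loop k r2 q r5 r6 a r9 r10 r11 r12 r13 r14 r15 r16 h :
    k <= n -> n <= a -> a + m <= q ->
  exists s10 s11 s12 s13 s14 s15 s16,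
  reach (65, [:: n; m; r2; 0; q; r5; r6; a; 0; r9; r10; r11; r12; r13; r14; r15; r16], h)
    (65, [:: n; m; r2; 0; q + k * m; r5; r6; a; k; r9; s10; s11; s12; s13; s14; s15; s16],
     write_rows h q a k)
    (k * (12 * m + 9)).
Proof.
move=> kn na aq; elim: k kn => [|k IH] kn.
  exists r10, r11, r12, r13, r14, r15, r16; rewrite addn0 (_ : write_rows h q a 0 = h); last first.
    by apply/funext.
  stop.
have {IH}[s10 [s11 [s12 [s13 [s14 [s15 [s16 IH]]]]]]] := IH (ltnW kn).
have [t11 [t15 [t16 par]]] := @parity_loop 70 m r2 (q + k * m) r5 r6 a k r9 s11 0 1 a
  s15 s16 (write_rows h q a k) (or_intror erefl) (leqnn m).
have eh : hits (write_rows h q a k) (q + k * m) a m = hits h (q + k * m) a m.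
  by apply: eq_hits => p pm; rewrite /write_rows; split; rewrite ifF //; lia.
rewrite {}eh in par; set o := odd _ in par.
exists m, t11, (if o then 1 else 0), (if o then 0 else 1), (a + m), t15, t16.
rewrite (_ : k.+1 * (12 * m + 9) = k * (12 * m + 9) + (12 * m + 4).+4.+1); last by lia.
apply: (reach_trans IH).
run1; rewrite leqNgt kn /=; do 4 run1; apply: (reach_trans par).
run1; rewrite leqnn; do 3 run1.
rewrite (_ : q + k.+1 * m = q + k * m + m); last by lia.
rewrite (_ : update _ _ _ = write_rows h q a k.+1); first by stop.
apply/funext=> x; rewrite /update /write_rows /= ltnS [x <= k]leq_eqVlt.
by case: (eqVneq x k) => [->|//]; rewrite -/o; case: (o).
Qed.

Definition corrected (h : nat -> nat) N p :=
  let q := (n + 3) * m in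
  if h ((n + 2) * m + p) + votes h true q (n * m) p N <=
     h ((n + 1) * m + p) + votes h false q (n * m) p N
  then h (n * m + p) else h (n * m + p) == 0.

(** Only the marks are constrained, so the lemma also covers an empty advice, with [N = 0]. *)
Lemma decoder_run N r2 h : 0 < n -> 0 < m ->
    (forall j, j < N -> 0 < h ((n + 3) * m + j * (2 * m + 1))) ->
    h ((n + 3) * m + N * (2 * m + 1)) = 0 ->
  exists t s, [/\ t <= 100 * ((n + N) * m),
    run decoder t (Config 0 (nth 0 [:: n; m; r2]) h) = s, halted decoder s &
    forall j, j < n -> memory s j =
      odd (\sum_(p < m) ((0 < h ((n + 3) * m + N * (2 * m + 1) + 1 + j * m + p))
                         && (0 < corrected h N p)))].
Proof.
move=> n0 m0 hN hE.
set Q := (n + 3) * m; set b := (n + 1) * m; set a := n * m.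
have nn : n + 3 <= n + 3 by [].
have [r10 p1] := @layout_loop (n + 3) r2 0 0 0 0 0 0 h (leq_addl n 3) nn.
have eq5 : (n + 3).-1 * m = b + m by rewrite /b; lia.
have eq6 : (n + 3 - 2) * m = b by rewrite /b; lia.
have eq7 : (n + 3 - 3) * m = a by rewrite /a; lia.
rewrite eq5 eq6 eq7 -/Q in p1.
have ab : a + m <= b by rewrite /a /b; lia.
have eQ : Q = b + 2 * m by rewrite /Q /b; lia.
have [s10 [s11 [s12 [s13 [s14 [s15 [s16 [h1 [p2 hout h1f h1t]]]]]]]]] :=
  @sample_loop N N r2 Q b a (n + 3) (n + 3) r10 0 0 0 0 0 0 h (leqnn N) ab eQ hN.
set QN := Q + N * (2 * m + 1) in p2.
have h1QN : h1 QN = 0 by rewrite hout // /QN; lia.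
have [u11 [u15 p3]] := @flip_loop m r2 QN.+1 b a (n + 3) (n + 3) 0 s15 s16 h1
  (leqnn m) ab.
have na : n <= a by rewrite /a leq_pmulr.
have aQN : a + m <= QN.+1 by rewrite /QN eQ; lia.
set h2 := flip_word _ _ _ _ in p3.
have [v10 [v11 [v12 [v13 [v14 [v15 [v16 p4]]]]]]] := @output_loop n r2 QN.+1 (b + m) b a
  (n + 3) m u11 (b + m) (b + m + m) (a + m) u15 s16 h2 (leqnn n) na aQN.
set s' := (_, _, write_rows _ _ _ _) in p4.
have : reach (0, [:: n; m; r2; 0; 0; 0; 0; 0; 0; 0; 0; 0; 0; 0; 0; 0; 0], h)
    (85, s'.1.2, s'.2) (100 * ((n + N) * m)).
  (* Layout, samples, majority and output, with the single steps between them. For [n = m = 1] and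
     [N = 0] the total is 98, whence the constant 100. *)
  apply: (@reach_le ((4 + (n + 3) * (4 * m + 8)) + (1 + (N * (22 * m + 10)
    + (14 * m + (n * (12 * m + 9) + 1).+2).+4.+3)))).
    have := leq_pmull m n0; have := leq_pmulr n m0; have := leq_pmulr N m0.
    by clear -n0 m0; lia.
  apply: (reach_trans p1).
  run1; rewrite leqnn; apply: (reach_trans p2).
  do 3 run1; rewrite h1QN /=; do 4 run1; apply: (reach_trans p3).
  run1; rewrite leqnn; run1; apply: (reach_trans p4); run1; rewrite leqnn; stop.
case/reach_run=> t tk et; exists t, (of_lconfig (85, s'.1.2, s'.2)); split=> //.
  rewrite -et; congr (run _ _ (Config _ _ _)); apply/funext=> x.
  by do 17 (case: x => [|x] //=); rewrite !nth_nil.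
move=> j jn; rewrite /= /write_rows jn; congr (nat_of_bool (odd _)).
apply: eq_bigr => -[p pm] _ /=.
rewrite (_ : h2 (a + p) = corrected h N p).
  rewrite (_ : h2 _ = h (QN + 1 + j * m + p)) // /h2 /flip_word ifF ?hout ?addn1 //.
    by rewrite /QN; lia.
  by rewrite /QN eQ; lia.
rewrite /h2 /flip_word leq_addr ltn_add2l pm addKn h1t // h1f // !hout; last by lia.
rewrite /corrected -/Q -/a -/b (_ : (n + 2) * m = b + m) //.
by rewrite /b; lia.
Qed.

End Decoder.

(** * Random parity checks *)

Local Open Scope ring_scope.

Lemma F2_cases (a : 'F_2) : {a = 0} + {a = 1}.
Proof. by case: a => -[|[|//]] ?; [left|right]; apply: val_inj. Qed.

Lemma F2_neq0 (a : 'F_2) : (a != 0) = (a == 1).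
Proof. by case: (F2_cases a) => ->. Qed.

Section Characters.
Variable R : realType.

Definition chi (a : 'F_2) : R := if a == 0 then 1 else -1.

Lemma chi0 : chi 0 = 1. Proof. by rewrite /chi eqxx. Qed.
Lemma chi1 : chi 1 = -1. Proof. by []. Qed.

Lemma chiD a b : chi (a + b) = chi a * chi b.
Proof.
by case: (F2_cases a) => ->; case: (F2_cases b) => ->;
  rewrite ?add0r ?addr0 ?chi0 ?chi1 ?mul1r ?mulr1 // (_ : 1 + 1 = 0 :> 'F_2)
          ?chi0 ?mulrNN ?mulr1 //; apply: val_inj.
Qed.

Lemma chi_sqr a : chi a * chi a = 1.
Proof. by rewrite /chi; case: ifP => _; rewrite ?mulrNN ?mulr1. Qed.

Lemma normr_chi a : `|chi a| = 1.
Proof. by rewrite /chi; case: ifP => _; rewrite ?normrN normr1. Qed.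

Lemma chi_sum (I : finType) (F : I -> 'F_2) :
  chi (\sum_i F i) = \prod_i chi (F i).
Proof. exact: (big_morph chi chiD chi0). Qed.

(** Orthogonality of characters: translating [y] by a unit vector at which [r] is nonzero negates
    every term. *)
Lemma sum_chi_mulmx n (r : 'rV['F_2]_n) :
  \sum_(y : 'cV_n) chi ((r *m y) 0 0) = (r == 0)%:R * 2 ^+ n.
Proof.
case: (eqVneq r 0) => [->|r0].
  under eq_bigr => y _ do rewrite mul0mx mxE chi0.
  by rewrite sumr_const card_mx card_Fp // muln1 mul1r natrX.
rewrite mul0r; have [j rj] : exists j, r 0 j != 0.
  apply/existsP; apply: contra_neqT r0; rewrite negb_exists => /forallP r0.
  by apply/rowP => j; rewrite mxE; apply/eqP/negPn.
set S := \sum_y _; suff : S = - S by move=> ?; lra.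
rewrite {1}/S (reindex_inj (addrI (delta_mx j 0))) -sumrN /=.
apply: eq_bigr => y _; rewrite mulmxDr mxE chiD -colE mxE.
by move: rj; rewrite F2_neq0 => /eqP ->; rewrite chi1 mulN1r.
Qed.

(** * Character sums over walks on the coordinates *)

Section Walks.
Variables m t : nat.
Implicit Types (v : 'cV['F_2]_m) (f : {ffun 'I_t -> 'I_m}).

Definition bias v : R := \sum_i chi (v i 0).

Lemma bias_wt v : bias v = m%:R - 2 * (wt v)%:R.
Proof.
transitivity (\sum_(i < m) (1 - 2 * (v i 0 != 0)%:R) : R).
  by apply: eq_bigr => i _; rewrite /chi; case: eqP => _; rewrite /=; lra.
rewrite sumrB sumr_const card_ord -mulr_sumr -natr_sum.
congr (_ - _ * _%:R); rewrite /wt -sum1_card [RHS]big_mkcond.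
by apply: eq_bigr => i _; rewrite inE; case: (_ != 0).
Qed.

(* [(-1)^<h, v>] for the check [h] that counts the visits of [f] modulo 2. *)
Definition walk f v : R := \prod_s chi (v (f s) 0).

Lemma walkD f v v' : walk f (v + v') = walk f v * walk f v'.
Proof. by rewrite /walk -big_split; apply: eq_bigr => s _; rewrite mxE chiD. Qed.

Definition odd_visits f (p : 'I_m) := odd #|[set s | f s == p]|.

(** Grouping the steps by visited coordinate turns the product into the parity that the decoder
    computes. *)
Lemma walk_odd_visits f v :
  walk f v = (-1) ^+ odd (\sum_(p < m) (odd_visits f p && (v p 0 != 0)%R)).
Proof.
rewrite signr_odd (big_morph _ (exprD (-1)) (expr0 (-1))) /walk.
rewrite (partition_big f xpredT) //=; apply: eq_bigr => p _.
rewrite (eq_bigr (fun=> chi (v p 0))) => [|s /eqP -> //].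
rewrite prodr_const /odd_visits cardsE /chi.
case: eqP => _; first by rewrite andbF expr1n.
by rewrite andbT signr_odd.
Qed.

Lemma sum_walk v : \sum_f walk f v = bias v ^+ t.
Proof.
rewrite /walk -(bigA_distr_bigA (fun (s : 'I_t) i => chi (v i 0))) /=.
by rewrite prodr_const card_ord.
Qed.

Definition once (j : 'I_m) f := #|[set s | f s == j]| == 1%N.

(** Fix the time of the only visit to [j]; the other [t.-1] steps range independently over the
    remaining coordinates. *)
Lemma sum_once j v : \sum_f (once j f)%:R * walk f v =
  t%:R * chi (v j 0) * (bias v - chi (v j 0)) ^+ t.-1.
Proof.
(* The product over [s] tests whether [s0] is the only time at which [j] is visited. *)
pose F (s0 s : 'I_t) (i : 'I_m) : R := ((i == j) == (s == s0))%:R * chi (v i 0).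
transitivity (\sum_(f : {ffun 'I_t -> 'I_m}) \sum_s0 \prod_s F s0 s (f s)).
  apply: eq_bigr => f _.
  under eq_bigr => s0 _ do rewrite /F big_split /= -/(walk f v).
  rewrite -mulr_suml; congr (_ * _).
  rewrite /once; case: (boolP (_ == _)) => [/cards1P[s0 es0]|ne].
    rewrite (bigD1 s0) //= big1 => [|s _]; last first.
      by have := in_set1 s s0; rewrite -es0 inE => ->; rewrite eqxx.
    rewrite big1 ?addr0 // => s1 s10; rewrite (bigD1 s0) //=.
    have := in_set1 s0 s0; rewrite -es0 inE eqxx => ->.
    by rewrite [s0 == s1]eq_sym (negbTE s10) mul0r.
  rewrite big1 // => s0 _; apply/eqP/prodf_eq0.
  have [s ss] : exists s, (f s == j) != (s == s0).
    apply/existsP; apply: contraNT ne; rewrite negb_exists => /forallP a.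
    apply/cards1P; exists s0; apply/setP => s; rewrite !inE.
    by have := a s; rewrite negbK => /eqP.
  by exists s; rewrite // (negbTE ss).
rewrite exchange_big /=.
transitivity (\sum_(s0 : 'I_t) chi (v j 0) * (bias v - chi (v j 0)) ^+ t.-1); last first.
  by rewrite sumr_const card_ord -[LHS]mulr_natl mulrA.
apply: eq_bigr => s0 _.
rewrite -(bigA_distr_bigA (F s0)) /= (bigD1 s0) //=; congr (_ * _).
  rewrite (bigD1 j) //= /F !eqxx mul1r big1 ?addr0 // => i /negbTE ->.
  by rewrite mul0r.
rewrite (eq_bigr (fun=> bias v - chi (v j 0))) => [|s /negbTE s0F].
  by rewrite prodr_const cardC1 card_ord.
rewrite /bias [RHS](_ : _ = \sum_(i | i != j) chi (v i 0)); last first.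
  by rewrite (bigD1 j) //= addrAC subrr add0r.
rewrite (bigD1 j) //= /F eqxx s0F mul0r add0r.
by apply: eq_bigr => i /negbTE ->; rewrite mul1r.
Qed.

End Walks.

(** * Walks that are parity checks of the code *)

Section Dual.
Variables (m n t : nat) (C : 'M['F_2]_(m, n)).

Definition dual : {set {ffun 'I_t -> 'I_m}} :=
  [set f : {ffun 'I_t -> 'I_m} | \sum_s row (f s) C == 0].

Lemma walk_code (f : {ffun 'I_t -> 'I_m}) (y : 'cV_n) :
  walk f (C *m y) = chi (((\sum_s row (f s) C) *m y) 0 0).
Proof.
rewrite /walk -chi_sum mulmx_suml summxE; congr (chi _).
by apply: eq_bigr => s _; rewrite -row_mul [RHS]mxE.
Qed.

Lemma walk_dual f (y : 'cV_n) : f \in dual -> walk f (C *m y) = 1.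
Proof. by rewrite inE walk_code => /eqP ->; rewrite mul0mx mxE chi0. Qed.

Lemma sum_walk_code (f : {ffun 'I_t -> 'I_m}) :
  \sum_(y : 'cV_n) walk f (C *m y) = (f \in dual)%:R * 2 ^+ n.
Proof. by rewrite inE -sum_chi_mulmx; apply: eq_bigr => y _; apply: walk_code. Qed.

(** Poisson summation: the indicator of [dual] is expanded over the characters indexed by [y], and
    the sum over walks is taken first. *)
Lemma card_dual : 2 ^+ n * #|dual|%:R = \sum_(y : 'cV_n) bias (C *m y) ^+ t.
Proof.
under eq_bigr => y _ do rewrite -sum_walk.
rewrite exchange_big /=; under eq_bigr => f _ do rewrite sum_walk_code.
rewrite -mulr_suml mulrC -natr_sum; congr (_%:R * _).
by rewrite -sum1_card [LHS]big_mkcond.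
Qed.

(** The vote of [f] on [e_j]: 1 if right, -1 if wrong, 0 if [f] abstains. *)
Definition signal (e : 'cV['F_2]_m) j (f : {ffun 'I_t -> 'I_m}) : R :=
  (once j f)%:R * (chi (e j 0) * walk f e).

(** Expanding [dual] shifts [e] by every codeword; the two factors [chi (e j 0)] cancel and leave
    the sign of the codeword at [j]. *)
Lemma sum_signal (e : 'cV['F_2]_m) j :
  2 ^+ n * \sum_(f in dual) signal e j f =
  t%:R * \sum_(y : 'cV_n) chi ((C *m y) j 0) *
    (bias (C *m y + e) - chi ((C *m y + e) j 0)) ^+ t.-1.
Proof.
rewrite big_mkcond /= mulr_sumr.
transitivity (\sum_(f : {ffun 'I_t -> 'I_m}) \sum_(y : 'cV_n) chi (e j 0) *
    ((once j f)%:R * walk f (C *m y + e))).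
  apply: eq_bigr => f _; rewrite -mulr_sumr -mulr_sumr.
  under eq_bigr => y _ do rewrite walkD.
  rewrite -mulr_suml sum_walk_code /signal; by case: (f \in dual) => /=; ring.
rewrite exchange_big mulr_sumr; apply: eq_bigr => y _.
rewrite -mulr_sumr sum_once [(_ + e) j 0]mxE chiD.
have := chi_sqr (e j 0); set x := chi (e j 0) => xx.
by rewrite -[RHS]mul1r -xx; ring.
Qed.


Variables beta eta : R.
Hypotheses (m0 : (0 < m)%N) (eta_ge : 1 / m%:R <= eta).
Hypotheses (beta0 : 0 <= beta).
Hypotheses (genC : generator_matrix C) (balC : balanced_code beta (code C)).

Lemma generator_mulmx_neq0 (y : 'cV['F_2]_n) : y != 0 -> C *m y != 0.
Proof.
apply: contra_neq => Cy0; have full : row_full C by rewrite /row_full genC.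
by rewrite -[y]mul1mx -(mulVpmx full) -mulmxA Cy0 mulmx0.
Qed.

Lemma normr_bias_code (y : 'cV['F_2]_n) : y != 0 -> `|bias (C *m y)| <= beta * m%:R.
Proof.
move=> /generator_mulmx_neq0 Cy0.
have yC : C *m y \in code C by apply/imsetP; exists y.
have /andP[] := balC yC Cy0.
by rewrite bias_wt ler_norml => h1 h2; apply/andP; split; lra.
Qed.

Lemma normr_biasD (v e : 'cV['F_2]_m) : `|bias (v + e) - bias v| <= 2 * (wt e)%:R.
Proof.
rewrite /bias -sumrB; apply: le_trans (ler_norm_sum _ _ _) _.
rewrite [leRHS](_ : _ = \sum_(i < m) (1 - chi (e i 0))).
  apply: ler_sum => i _; rewrite mxE chiD -{2}[chi (v i 0)]mulr1 -mulrBr normrM normr_chi.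
  by rewrite mul1r distrC ger0_norm // /chi; case: ifP => _; lra.
by rewrite sumrB -/(bias e) bias_wt sumr_const card_ord; ring.
Qed.

(** The zero codeword gives [m ^ t]; by balance each other one gives at most [(beta m) ^ t]. *)
Lemma card_dual_le :
  2 ^+ n * #|dual|%:R <= m%:R ^+ t * (1 + 2 ^+ n * beta ^+ t).
Proof.
have bias0 : bias (0 : 'cV['F_2]_m) = m%:R.
  by rewrite /bias; under eq_bigr => i _ do rewrite mxE chi0; rewrite sumr_const card_ord.
rewrite card_dual (bigD1 0) //= mulmx0 bias0 mulrDr mulr1 lerD2l.
apply: (@le_trans _ _ (\sum_(y : 'cV['F_2]_n) (beta * m%:R) ^+ t)); last first.
  rewrite sumr_const card_mx card_Fp // muln1 -[leLHS]mulr_natl natrX exprMn.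
  by rewrite [leRHS]mulrC -mulrA.
rewrite big_mkcond /=; apply: ler_sum => y _; case: eqP => [_|/eqP y0] /=.
  by rewrite exprn_ge0 // mulr_ge0.
apply: le_trans (ler_norm _) _; rewrite normrX lerXn2r ?nnegrE ?mulr_ge0 //.
exact: normr_bias_code.
Qed.

(** The main term is [y = 0]. In [3 * eta], two parts pay for the weight of [e] and the third for
    the subtracted sign, since [1 <= eta * m]. *)
Lemma sum_signal_ge (e : 'cV['F_2]_m) j :
    (wt e)%:R < eta * m%:R -> eta < 1 / 3 ->
  t%:R * m%:R ^+ t.-1 *
     ((1 - 3 * eta) ^+ t.-1 - 2 ^+ n * (beta + 3 * eta) ^+ t.-1) <=
  2 ^+ n * \sum_(f in dual) signal e j f.
Proof.
move=> we eta3; rewrite sum_signal -mulrA ler_wpM2l // mulrBr.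
have m0R : 0 < m%:R :> R by rewrite ltr0n.
have etam : 1 <= eta * m%:R by rewrite -ler_pdivrMr.
have eta0 : 0 <= eta by apply: le_trans eta_ge; rewrite divr_ge0.
have we0 : 0 <= (wt e)%:R :> R by [].
rewrite (bigD1 0) //= mulmx0 add0r [(0 : 'cV_m) j 0]mxE chi0 mul1r.
apply: lerD.
  rewrite -exprMn lerXn2r // ?nnegrE ?mulr_ge0 //; try lra.
    rewrite bias_wt /chi; case: ifP => _; nra.
  by rewrite bias_wt /chi; case: ifP => _; nra.
rewrite lerNl -sumrN.
apply: (@le_trans _ _ (\sum_(y : 'cV['F_2]_n) ((beta + 3 * eta) * m%:R) ^+ t.-1)); last first.
  rewrite sumr_const card_mx card_Fp // muln1 -[leLHS]mulr_natl natrX exprMn.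
  by rewrite [leRHS]mulrC -mulrA.
have be0 : 0 <= (beta + 3 * eta) * m%:R by rewrite mulr_ge0 // addr_ge0 // mulr_ge0.
rewrite big_mkcond /=; apply: ler_sum => y _; case: eqP => [_|/eqP y0] /=.
  by rewrite exprn_ge0.
apply: le_trans (ler_norm _) _; rewrite normrN normrM normr_chi mul1r normrX.
rewrite lerXn2r ?nnegrE //.
have := normr_bias_code y0; have := normr_biasD (C *m y) e.
have := normr_chi ((C *m y + e) j 0).
set a := bias (_ + _); set b := bias _; set c := chi _ => hc hab hb.
apply: le_trans (ler_normB _ _) _; rewrite hc.
have -> : a = (a - b) + b by ring.
apply: le_trans (lerD (ler_normD _ _) (lexx 1)) _; nra.
Qed.

End Dual.
End Characters.

(* Chernoff bound with the rational base [1 + g / 2]. *)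
Lemma exists_majority (R : realType) (T E : finType) (D : {set T}) (B : {set E})
    (X : E -> T -> R) (g : R) (N : nat) :
    (forall e f, [\/ X e f = 0, X e f = 1 | X e f = -1]) ->
    (0 < #|D|)%N -> 0 <= g ->
    (forall e, e \in B -> g * #|D|%:R <= \sum_(f in D) X e f) ->
    #|B|%:R * (1 - g ^+ 2 / 4) ^+ N < 1 ->
  exists F : {ffun 'I_N -> T}, (forall i, F i \in D) /\
    forall e, e \in B -> 0 < \sum_i X e (F i).
Proof.
move=> X3 D0 g0 gX BN.
have D0R : 0 < #|D|%:R :> R by rewrite ltr0n.
pose z : R := 1 + g / 2.
have z1 : 1 <= z by rewrite /z; lra.
have z0 : 0 < z by lra.
pose Z e f : R := expR (- X e f * ln z).
(* A quadratic bound on [z ^ (- X)]. Averaged with [gX] it gives [1 + g ^ 2 / 4 - g ^ 2 / 2], the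
   factor lost per sample. *)
have ZX e f : Z e f <= 1 - g / 2 * X e f + (g / 2) ^+ 2.
  have sq : 0 <= (g / 2) ^+ 2 by rewrite sqr_ge0.
  rewrite /Z; case: (X3 e f) => ->; rewrite ?oppr0 ?opprK ?mul0r ?mul1r ?mulN1r ?expR0.
  - by lra.
  - rewrite expRN lnK // -div1r ler_pdivrMr // /z -subr_ge0.
    by rewrite [leRHS](_ : _ = (g / 2) ^+ 3); [rewrite exprn_ge0 //; lra|ring].
  - by rewrite lnK // /z; lra.
have ZD e : e \in B -> \sum_(f in D) Z e f <= #|D|%:R * (1 - g ^+ 2 / 4).
  move=> eB; apply: (@le_trans _ _ (\sum_(f in D) (1 + (g / 2) ^+ 2 - g / 2 * X e f))).
    by apply: ler_sum => f _; apply: le_trans (ZX e f) _; lra.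
  rewrite sumrB sumr_const -mulr_sumr -[_ *+ #|D|]mulr_natl.
  have := gX e eB; set S := \sum_(_ in _) _; move: D0R; set d := #|D|%:R => d0 gd.
  have := ler_wpM2l (_ : 0 <= g / 2) gd; rewrite divr_ge0 // => /(_ isT); nra.
pose bad e (F : {ffun 'I_N -> T}) := \sum_i X e (F i) <= 0.
pose DN : pred {ffun 'I_N -> T} := fun F => F \in ffun_on (mem D).
have badDN e : e \in B ->
    \sum_(F | DN F) (bad e F)%:R <= (#|D|%:R * (1 - g ^+ 2 / 4)) ^+ N.
  (* Markov's inequality: when [F] is bad, the product of the [Z e (F i)] is at least 1. *)
  move=> eB; apply: (@le_trans _ _ (\sum_(F | DN F) \prod_i Z e (F i))).
    apply: ler_sum => F _; rewrite /Z -expR_sum.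
    case: (boolP (bad e F)) => [bF|_] /=; last exact: expR_ge0.
    rewrite -expR0 ler_expR -mulr_suml sumrN mulr_ge0 ?oppr_ge0 //.
    by rewrite ln_ge0.
  rewrite -(bigA_distr_big _ (fun _ : 'I_N => Z e)) /= prodr_const card_ord.
  have S0 : 0 <= \sum_(f in D) Z e f by apply: sumr_ge0 => f _; apply: expR_ge0.
  by rewrite lerXn2r ?nnegrE //; [apply: le_trans (ZD e eB)|apply: ZD].
case: (boolP [exists F, DN F && [forall (e | e \in B), ~~ bad e F]]).
  case/existsP => F /andP[/ffun_onP FD /forallP FB].
  exists F; split=> // e eB; rewrite ltNge; exact: (implyP (FB e)).
(* If every tuple were bad for some [e], counting the [#|D| ^ N] tuples would contradict the union
   bound. *)
rewrite negb_exists => /forallP allbad; exfalso.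
have : #|D|%:R ^+ N <= \sum_(e in B) \sum_(F | DN F) (bad e F)%:R :> R.
  rewrite exchange_big /= -natrX.
  have -> : (#|D| ^ N)%N = #|[pred F : {ffun 'I_N -> T} | F \in ffun_on (mem D)]|.
    by rewrite card_ffun_on card_ord.
  rewrite -sum1_card natr_sum; apply: ler_sum => F DF.
  move: (allbad F); rewrite (DF : DN F) negb_forall => /existsP[e].
  rewrite negb_imply negbK => /andP[eB bF]; rewrite (bigD1 e) //= bF lerDl.
  by apply: sumr_ge0.
apply/negP; rewrite -ltNge.
apply: (@le_lt_trans _ _ (\sum_(e in B) (#|D|%:R * (1 - g ^+ 2 / 4)) ^+ N)).
  exact: ler_sum.
by rewrite sumr_const -[ltLHS]mulr_natl exprMn mulrCA gtr_pMr ?exprn_gt0.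
Qed.

(** * Choice of the constants *)

Section Constants.
Variables (R : realType) (n m : nat) (beta eta : R).
Hypotheses (n0 : (0 < n)%N) (nm : (n < m)%N).
Hypotheses (beta_itv : 1 / m%:R <= beta < 1 / 8) (eta_itv : 1 / m%:R <= eta < 1 / 8).

Let alpha := beta + 2 * eta.
Let l := log2 (1 / alpha).

Let m0 : 0 < m%:R :> R. Proof. by rewrite ltr0n (ltn_trans n0). Qed.
Let nR0 : 0 < n%:R :> R. Proof. by rewrite ltr0n. Qed.
Let m_inv0 : 0 < 1 / m%:R :> R. Proof. by rewrite divr_gt0. Qed.
Let alpha0 : 0 < alpha.
Proof.
have [mi [/andP[b1 b8] /andP[e1 e8]]] := (m_inv0, (beta_itv, eta_itv)).
by rewrite /alpha; lra.
Qed.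
Let alpha38 : alpha < 3 / 8.
Proof.
have [mi [/andP[b1 b8] /andP[e1 e8]]] := (m_inv0, (beta_itv, eta_itv)).
by rewrite /alpha; lra.
Qed.
Let ln2_gt0 : 0 < ln 2 :> R. Proof. by rewrite ln_gt0 // ltr1n. Qed.

Lemma blocklength_ge9 : (9 <= m)%N.
Proof.
case/andP: beta_itv => b1 b8; have : 1 / m%:R < 1 / 8 :> R by apply: le_lt_trans b8.
by rewrite !div1r ltf_pV2 ?posrE // ltr_nat.
Qed.

(** From [alpha < 3 / 8] and [2 ^ 7 <= (8 / 3) ^ 5]. *)
Lemma log2_inv_alpha_ge : 7 / 5 <= l.
Proof.
rewrite /l /log2 ler_pdivlMr // -(ler_pM2l (_ : 0 < 5)) //.
have -> : 5 * (7 / 5 * ln 2) = ln 2 *+ 7 :> R by rewrite -mulr_natl; field.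
rewrite mulr_natl -!lnXn // ?divr_gt0 // ler_ln ?posrE ?exprn_gt0 ?divr_gt0 //.
apply: (@le_trans _ _ ((8 / 3) ^+ 5)); first by lra.
rewrite lerXn2r ?nnegrE ?divr_ge0 ?(ltW alpha0) // ler_pdivlMr //.
by have := alpha38; lra.
Qed.

(** Here [beta + 3 * eta <= 3 / 2 * alpha] and [1 - 3 * eta >= 5 / 8]. At [alpha = 3 / 8] these
    bounds have ratio [9 / 10], whose tenth power is the first below [3 / 8]. *)
Lemma ratio_pow10 : (beta + 3 * eta) ^+ 10 <= alpha * (1 - 3 * eta) ^+ 10.
Proof.
have [mi [/andP[b1 b8] /andP[e1 e8]]] := (m_inv0, (beta_itv, eta_itv)).
apply: (@le_trans _ _ ((3 / 2 * alpha) ^+ 10)).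
  by rewrite lerXn2r ?nnegrE; rewrite /alpha; lra.
apply: (@le_trans _ _ (alpha * (5 / 8) ^+ 10)); last first.
  apply: ler_wpM2l; first exact: (ltW alpha0).
  by apply: lerXn2r; rewrite ?nnegrE; lra.
rewrite exprMn [alpha ^+ 10]exprS mulrCA; apply: ler_wpM2l; first exact: (ltW alpha0).
apply: (@le_trans _ _ ((3 / 2) ^+ 10 * (3 / 8) ^+ 9)); last by lra.
apply: ler_wpM2l; first by rewrite exprn_ge0 // divr_ge0.
by apply: lerXn2r; rewrite ?nnegrE ?divr_ge0 ?(ltW alpha0) ?(ltW alpha38).
Qed.

Lemma alpha_powl (k : nat) (x : R) : x <= k%:R * l -> alpha ^+ k <= expR (- x * ln 2).
Proof.
move=> xk; rewrite -[alpha]lnK ?posrE // -expRM_natl ler_expR.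
have -> : ln alpha = - (l * ln 2).
  by rewrite /l /log2 divfK ?gt_eqF // div1r lnV ?posrE // opprK.
by rewrite mulrN mulNr lerN2 mulrA ler_pM2r.
Qed.

(** At the tenth power, [alpha ^ k <= 2 ^ (- 20 n)] offsets [4 ^ (10 n)]. Base 4 instead of 2 leaves
    a spare factor [2 ^ n]. *)
Lemma ratio_pow (k : nat) : 20 * n%:R <= k%:R * l ->
  4 ^+ n * (beta + 3 * eta) ^+ k <= (1 - 3 * eta) ^+ k.
Proof.
have [mi [/andP[b1 b8] /andP[e1 e8]]] := (m_inv0, (beta_itv, eta_itv)).
move=> nk; rewrite -(ler_pXn2r (_ : (0 < 10)%N)) ?nnegrE //; last first.
- by rewrite exprn_ge0 //; lra.
- by rewrite mulr_ge0 ?exprn_ge0 //; lra.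
rewrite exprMn -!exprM ![(k * 10)%N]mulnC ![in X in _ * X]exprM [leRHS]exprM.
have u0 : 0 <= (beta + 3 * eta) ^+ 10 by rewrite exprn_ge0 //; lra.
have v0 : 0 <= (1 - 3 * eta) ^+ 10 by rewrite exprn_ge0 //; lra.
apply: (@le_trans _ _ (4 ^+ (n * 10) * (alpha ^+ k * ((1 - 3 * eta) ^+ 10) ^+ k))).
  apply: ler_wpM2l; first exact: exprn_ge0.
  rewrite -exprMn; apply: lerXn2r; rewrite ?nnegrE //; last exact: ratio_pow10.
  by apply: mulr_ge0 => //; exact: ltW alpha0.
rewrite mulrA; apply: ler_piMl; first exact: exprn_ge0.
apply: (@le_trans _ _ (4 ^+ (n * 10) * expR (- (20 * n%:R) * ln 2))).
  by apply: ler_wpM2l; [exact: exprn_ge0|exact: alpha_powl].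
have -> : 4 ^+ (n * 10) = expR (20 * n%:R * ln 2) :> R.
  have -> : 20 * n%:R = (2 * (n * 10))%:R :> R by rewrite !natrM; ring.
  by rewrite expRM_natl lnK ?posrE // [RHS]exprM (_ : 2 ^+ 2 = 4 :> R) //; lra.
by rewrite mulNr -expRD subrr expR0.
Qed.


(** Walks get length [k.+2]: the exponent [k.+1] exceeds the [20 n / l] needed for the ratio, and
    [k] is bounded for the decay. Taking 64 instead of 20 lowers the constant in the number of
    samples. *)
Lemma walk_length_exists : exists k : nat,
  [/\ 64 * n%:R / l <= k.+1%:R & k%:R <= 64 * n%:R / l].
Proof.
have l0 : 0 < l by have := log2_inv_alpha_ge; lra.
have x0 : 0 <= 64 * n%:R / l by apply: divr_ge0; [exact: mulr_ge0|exact: ltW].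
exists (Num.truncn (64 * n%:R / l)).
have /andP[h1 h2] := truncn_itv x0; split; [exact: ltW h2|exact: h1].
Qed.

(** A lower bound on the mean of [signal] over [dual]. In the 4, one factor 2 pays for the nonzero
    codewords in the size of [dual], the other for those in the sum of signals. *)
Definition gap (t : nat) : R := t%:R / (4 * m%:R) * (1 - 3 * eta) ^+ t.-1.

Lemma gap_gt0 t : (0 < t)%N -> 0 < gap t.
Proof.
move=> t0; have [mi [/andP[b1 b8] /andP[e1 e8]]] := (m_inv0, (beta_itv, eta_itv)).
rewrite mulr_gt0 ?divr_gt0 ?ltr0n ?mulr_gt0 ?exprn_gt0 //; lra.
Qed.

(** There are [2 ^ m * m] pairs [(e, j)]. The power is at most [exp (- 2 m)]; conclude by
    [m < 2 ^ m] and [4 <= exp 2]. *)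
Lemma union_bound (g : R) (N : nat) : 0 < g -> g <= 1 -> 8 * m%:R / g ^+ 2 <= N%:R ->
  (2 ^ m * m)%:R * (1 - g ^+ 2 / 4) ^+ N < 1.
Proof.
move=> g0 g1 hN; have g2 : 0 < g ^+ 2 by rewrite exprn_gt0.
have g21 : g ^+ 2 <= 1 by rewrite expr_le1 // ltW.
have e1 : (1 - g ^+ 2 / 4) ^+ N <= expR (- 2) ^+ m.
  apply: (@le_trans _ _ (expR (- (g ^+ 2 / 4)) ^+ N)).
    by apply: lerXn2r; rewrite ?nnegrE ?expR_ge0 ?expR_ge1Dx //; lra.
  rewrite -!expRM_natl ler_expR; move: hN; rewrite ler_pdivrMr //; lra.
apply: (@le_lt_trans _ _ ((2 ^ m * m)%:R * expR (- 2) ^+ m)).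
  by apply: ler_wpM2l.
have m0' : (0 < m)%N by rewrite (ltn_trans n0).
apply: (@lt_le_trans _ _ ((2 ^ m * 2 ^ m)%:R * expR (- 2) ^+ m)).
  by rewrite ltr_pM2r ?exprn_gt0 ?expR_gt0 // ltr_nat ltn_pmul2l ?expn_gt0 // ltn_expl.
rewrite -expnMn natrX -exprMn; apply: exprn_ile1.
  by apply: mulr_ge0 => //; exact: expR_ge0.
rewrite expRN ler_pdivrMr ?expR_gt0 // mul1r.
have -> : 2 = 2%:R * 1 :> R by rewrite mulr1.
rewrite expRM_natl expr2; have := expR_ge1Dx (1 : R).
by rewrite (_ : (2 * 2)%:R = 4) //; nra.
Qed.

(** Since [0 <= eta <= 2 / 15], [(1 - 3 * eta) * (1 + 5 * eta) >= 1]. *)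
Lemma inv_sqr_decay_le : (1 - 3 * eta) ^- 2 <= expR (10 * eta).
Proof.
have [mi [/andP[b1 b8] /andP[e1 e8]]] := (m_inv0, (beta_itv, eta_itv)).
have v0 : 0 < 1 - 3 * eta by lra.
have -> : 10 * eta = 2%:R * (5 * eta) by ring.
rewrite expRM_natl -exprVn; apply: lerXn2r; rewrite ?nnegrE ?invr_ge0 ?expR_ge0 ?(ltW v0) //.
rewrite -div1r ler_pdivrMr //; have := expR_ge1Dx (5 * eta); nra.
Qed.

(** Of the [k.+1] decay factors one is bounded by [(8 / 5) ^ 2], the others by [exp (10 eta)] each,
    whence [640 = 10 * 64]. The constant is [128 / 64 ^ 2 * (64 / 25) = 2 / 25]. *)
Lemma sample_count_le (k : nat) :
    64 * n%:R / l <= k.+1%:R -> k%:R <= 64 * n%:R / l ->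
  8 * m%:R / gap k.+2 ^+ 2 <=
  2 / 25 * (m%:R * (m%:R ^+ 2 * l ^+ 2 / n%:R ^+ 2 * expR (640 * (eta * n%:R / l)))).
Proof.
move=> kl lk; have [mi [/andP[b1 b8] /andP[e1 e8]]] := (m_inv0, (beta_itv, eta_itv)).
have l0 : 0 < l by have := log2_inv_alpha_ge; lra.
have v0 : 0 < 1 - 3 * eta by lra.
have eta0 : 0 <= eta by lra.
have vk : ((1 - 3 * eta) ^- 2) ^+ k.+1 <= 64 / 25 * expR (640 * (eta * n%:R / l)).
  rewrite exprS; apply: ler_pM; rewrite ?exprn_ge0 ?invr_ge0 ?exprn_ge0 ?(ltW v0) //.
    rewrite -div1r ler_pdivrMr ?exprn_gt0 //; nra.
  apply: (@le_trans _ _ (expR (10 * eta) ^+ k)).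
    by apply: lerXn2r; rewrite ?nnegrE ?expR_ge0 ?invr_ge0 ?exprn_ge0 ?(ltW v0) ?inv_sqr_decay_le.
  rewrite -expRM_natl ler_expR.
  have -> : 640 * (eta * n%:R / l) = 64 * n%:R / l * (10 * eta) by ring.
  by apply: ler_wpM2r => //; lra.
have tk : (k.+2%:R ^+ 2)^-1 <= l ^+ 2 / (4096 * n%:R ^+ 2) :> R.
  have -> : l ^+ 2 / (4096 * n%:R ^+ 2) = ((64 * n%:R / l) ^+ 2)^-1.
    by field; rewrite !gt_eqF //.
  have y0 : 0 < 64 * n%:R / l by apply: divr_gt0 => //; exact: mulr_gt0.
  rewrite lef_pV2 ?posrE ?exprn_gt0 //.
  apply: lerXn2r; rewrite ?nnegrE ?(ltW y0) //.
  by apply: le_trans kl _; rewrite ler_nat.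
have -> : 8 * m%:R / gap k.+2 ^+ 2 =
    128 * m%:R ^+ 3 * ((k.+2%:R ^+ 2)^-1 * ((1 - 3 * eta) ^- 2) ^+ k.+1).
  have -> : ((1 - 3 * eta) ^- 2) ^+ k.+1 = ((1 - 3 * eta) ^+ k.+1) ^- 2.
    by rewrite exprVn -!exprM mulnC.
  have V0 : 0 < (1 - 3 * eta) ^+ k.+1 by exact: exprn_gt0.
  have t0 : 0 < k.+2%:R :> R by rewrite ltr0n.
  rewrite /gap [k.+2.-1]/=.
  move: ((1 - 3 * eta) ^+ k.+1) (k.+2%:R : R) V0 t0 => V t V0 t0.
  by field; rewrite !gt_eqF.
have -> : 2 / 25 * (m%:R * (m%:R ^+ 2 * l ^+ 2 / n%:R ^+ 2 * expR (640 * (eta * n%:R / l)))) =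
    128 * m%:R ^+ 3 * (l ^+ 2 / (4096 * n%:R ^+ 2) * (64 / 25 * expR (640 * (eta * n%:R / l)))).
  by field; rewrite !gt_eqF.
apply: ler_wpM2l; first by rewrite mulr_ge0 ?exprn_ge0.
by apply: ler_pM => //; rewrite ?exprn_ge0 ?invr_ge0 ?exprn_ge0 ?(ltW v0).
Qed.

(** The samples take about [4 / 25] of the bound [m ^ 2 * G]; [G >= 49 / 25], [m >= 9] and [n < m]
    absorb the rest. *)
Lemma advice_length_le (N : nat) :
    N%:R <= 1 + 2 / 25 * (m%:R *
      (m%:R ^+ 2 * l ^+ 2 / n%:R ^+ 2 * expR (640 * (eta * n%:R / l)))) ->
  (2 * m + (N * (2 * m + 1) + (1 + n * m)))%:R <= bound 640 n m beta eta.
Proof.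
set G := m%:R ^+ 2 * l ^+ 2 / _ * _ => NG.
have -> : bound 640 n m beta eta = m%:R ^+ 2 * G.
  by rewrite /bound -/alpha -/l /G; field; rewrite gt_eqF.
have [mi [/andP[b1 b8] /andP[e1 e8]]] := (m_inv0, (beta_itv, eta_itv)).
have l75 := log2_inv_alpha_ge.
have m9 : 9 <= m%:R :> R by rewrite ler_nat blocklength_ge9.
have nmR : n%:R + 1 <= m%:R :> R by rewrite natr1 ler_nat.
have G49 : 49 / 25 <= G.
  have -> : 49 / 25 = 49 / 25 * 1 :> R by rewrite mulr1.
  apply: ler_pM => //; first by lra.
    have -> : m%:R ^+ 2 * l ^+ 2 / n%:R ^+ 2 = (m%:R / n%:R * l) ^+ 2.
      by field; rewrite gt_eqF.
    have mn1 : 1 <= m%:R / n%:R :> R.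
      by rewrite ler_pdivlMr // mul1r ler_nat ltnW.
    have : 7 / 5 <= m%:R / n%:R * l by nra.
    by nra.
  rewrite -[leLHS]expR0 ler_expR; apply: mulr_ge0 => //; apply: divr_ge0; last by lra.
  by apply: mulr_ge0 => //; lra.
rewrite !(natrD, natrM).
move: m9 nmR G49 NG nR0; set M := m%:R; set g := G; set nn := n%:R; set NN := N%:R.
move=> M9 nM G49 NG n1.
have h1 : NN * (2 * M + 1) <= (1 + 2 / 25 * (M * g)) * (2 * M + 1).
  by apply: ler_wpM2r => //; lra.
have h2 : nn * M <= (M - 1) * M by apply: ler_wpM2r; lra.
have h3 : (49 / 25) * M <= g * M by apply: ler_wpM2r; lra.
have h4 : (g * M) * 9 <= (g * M) * M by apply: ler_wpM2l => //; lra.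
have h5 : (49 / 25) * M * M <= g * M * M by apply: ler_wpM2r; lra.
have h6 : 9 * M <= M * M by apply: ler_wpM2r; lra.
by lra.
Qed.

End Constants.

(** * Existence of the samples *)

Lemma signal_values (R : realType) m t (e : 'cV['F_2]_m) j (f : {ffun 'I_t -> 'I_m}) :
  [\/ signal R e j f = 0, signal R e j f = 1 | signal R e j f = -1].
Proof.
rewrite /signal /walk -chi_sum -chiD; case: (once j f); last by rewrite mul0r; constructor 1.
rewrite mul1r /chi; case: ifP => _; [constructor 2|constructor 3] => //.
Qed.

Lemma samples_exist (R : realType) n m (beta eta : R) (C : 'M['F_2]_(m, n)) k N :
    (0 < n)%N -> (n < m)%N ->
    1 / m%:R <= beta < 1 / 8 -> 1 / m%:R <= eta < 1 / 8 ->
    64 * n%:R / log2 (1 / (beta + 2 * eta)) <= k.+1%:R ->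
    8 * m%:R / gap m eta k.+2 ^+ 2 <= N%:R ->
    generator_matrix C -> balanced_code beta (code C) ->
  exists F : {ffun 'I_N -> {ffun 'I_k.+2 -> 'I_m}},
    (forall i, F i \in dual k.+2 C) /\
    forall e j, (wt e)%:R < eta * m%:R -> 0 < \sum_i signal R e j (F i).
Proof.
move=> n0 nm bI eI kl hN genC balC.
have m0 : (0 < m)%N by apply: ltn_trans nm.
have m0R : 0 < m%:R :> R by rewrite ltr0n.
have mi : 0 < 1 / m%:R :> R by rewrite divr_gt0.
have [[/andP[b1 b8] /andP[e1 e8]]] := (bI, eI).
have l75 := log2_inv_alpha_ge n0 nm bI eI.
have b0 : 0 <= beta by lra.
set l := log2 _ in kl l75.
have l0 : 0 < l by lra.
have g0 := gap_gt0 n0 nm bI eI (ltn0Sn k.+1).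
set g := gap _ _ _ in g0 hN.
have h20 : 20 * n%:R <= k.+1%:R * l.
  by move: kl; rewrite ler_pdivrMr //; have := ler0n R n; lra.
have rp := ratio_pow n0 nm bI eI h20.
have n2 : 2 <= 2 ^+ n :> R.
  by rewrite -[leLHS]expr1 ler_weXn2l // ler1n.
have e4 : 4 ^+ n = 2 ^+ n * 2 ^+ n :> R by rewrite -exprMn; congr (_ ^+ _); lra.
set v := (1 - 3 * eta) ^+ k.+1 in rp; set u := (beta + 3 * eta) ^+ k.+1 in rp.
have v0 : 0 < v by apply: exprn_gt0; lra.
have v1 : v <= 1 by apply: exprn_ile1; lra.
have u0 : 0 <= u by apply: exprn_ge0; lra.
(* One of the two factors [2 ^ n] of [4 ^ n] is at least 2 and provides the half. *)
have uv : 2 ^+ n * u <= v / 2.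
  have := mulr_ge0 (_ : 0 <= 2 ^+ n :> R) u0; rewrite exprn_ge0 // => /(_ isT) pu.
  by move: rp; rewrite e4 -mulrA; nra.
have bt : 2 ^+ n * beta ^+ k.+2 <= 1.
  apply: (@le_trans _ _ (2 ^+ n * u)); last by lra.
  apply: ler_wpM2l; first exact: exprn_ge0.
  apply: (@le_trans _ _ (beta ^+ k.+1)); first by apply: ler_wiXn2l => //; lra.
  by apply: lerXn2r; rewrite ?nnegrE; lra.
pose D := dual k.+2 C.
have n2pos : 0 < 2 ^+ n :> R by apply: exprn_gt0.
have key e j : (wt e)%:R < eta * m%:R -> g * #|D|%:R <= \sum_(f in D) signal R e j f.
  move=> we; have e3 : eta < 1 / 3 by lra.
  have := sum_signal_ge k.+2 m0 e1 b0 genC balC j we e3.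
  have := card_dual_le k.+2 b0 genC balC.
  rewrite [k.+2.-1]/= -/u -/v -/D; set S := \sum_(f in D) _ => cD sS.
  rewrite -(ler_pM2l n2pos); apply: le_trans sS.
  rewrite mulrCA; apply: (@le_trans _ _ (g * (m%:R ^+ k.+2 * 2))).
    apply: ler_wpM2l; first exact: ltW.
    apply: le_trans cD _; apply: ler_wpM2l; first exact: exprn_ge0.
    by lra.
  have -> : g * (m%:R ^+ k.+2 * 2) = k.+2%:R * m%:R ^+ k.+1 * (v / 2).
    by rewrite /g /gap [k.+2.-1]/= -/v [m%:R ^+ k.+2]exprS; field; rewrite gt_eqF.
  apply: ler_wpM2l; first by rewrite mulr_ge0 ?exprn_ge0.
  by lra.
have w0 : (wt (0 : 'cV['F_2]_m))%:R < eta * m%:R :> R.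
  rewrite (_ : wt _ = 0)%N; last by apply: eq_card0 => i; rewrite inE mxE eqxx.
  by apply: mulr_gt0 => //; lra.
(* The sum of signals at the zero word is positive, so it is not empty. *)
have D0 : (0 < #|D|)%N.
  have := sum_signal_ge k.+2 m0 e1 b0 genC balC (Ordinal m0) w0 (_ : eta < 1 / 3).
  rewrite [k.+2.-1]/= -/u -/v -/D lt0n => /(_ ltac:(lra)).
  apply: contraTneq => /card0_eq D0; rewrite big_pred0 // mulr0 -ltNge.
  apply: mulr_gt0; last by lra.
  by rewrite mulr_gt0 ?exprn_gt0 ?ltr0n.
have g1 : g <= 1.
  have D0R : 0 < #|D|%:R :> R by rewrite ltr0n.
  rewrite -(ler_pM2r D0R) mul1r; apply: le_trans (key _ (Ordinal m0) w0) _.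
  rewrite -sum1_card natr_sum; apply: ler_sum => f _.
  by case: (@signal_values R _ _ 0 (Ordinal m0) f) => ->; lra.
pose B := [set ej : 'cV['F_2]_m * 'I_m | (wt ej.1)%:R < eta * m%:R].
have BN : #|B|%:R * (1 - g ^+ 2 / 4) ^+ N < 1.
  apply: le_lt_trans (union_bound n0 nm g0 g1 hN).
  have g21 : g ^+ 2 <= 1 by apply: exprn_ile1 => //; exact: ltW.
  apply: ler_wpM2r; first by apply: exprn_ge0; lra.
  rewrite ler_nat; apply: leq_trans (max_card _) _.
  by rewrite card_prod card_mx card_Fp // muln1 card_ord.
have [|F [FD Fpos]] := @exists_majority R _ _ D B
  (fun ej f => signal R ej.1 ej.2 f) g N (fun ej f => signal_values R ej.1 ej.2 f) D0
  (ltW g0) _ BN.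
  by move=> [e j]; rewrite inE; apply: key.
by exists F; split=> // e j we; apply: (Fpos (e, j)); rewrite inE.
Qed.

(** * The advice *)

Local Open Scope nat_scope.

(** Indices obtained by division are natural numbers, hence the default [false] out of range. *)
Definition bit a b (H : 'I_a -> 'I_b -> bool) (i p : nat) : bool :=
  if (insub i, insub p) is (Some i', Some p') then H i' p' else false.

Lemma bitE a b (H : 'I_a -> 'I_b -> bool) (i : 'I_a) (p : 'I_b) : bit H i p = H i p.
Proof. by rewrite /bit !valK. Qed.

Section Advice.
Variables (m n N : nat) (H U : 'I_N -> 'I_m -> bool) (L : 'I_n -> 'I_m -> bool).

(* The layout read by the decoder: [2 m] cells for the counters, then for each
   sample a mark 1, its check (a row of [H]) and its votes (a row of [U]), then
   a mark 0 and the rows of [L]. *)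
Definition advice_entry (x : nat) : bool :=
  if x < 2 * m then false else
  let y := x - 2 * m in
  if y < N * (2 * m + 1) then
    let i := y %/ (2 * m + 1) in
    let r := y %% (2 * m + 1) in
    if r == 0 then true else if r <= m then bit H i r.-1 else bit U i (r.-1 - m)
  else if y == N * (2 * m + 1) then false
  else let z := y - N * (2 * m + 1) - 1 in bit L (z %/ m) (z %% m).

Definition advice : seq bool :=
  mkseq advice_entry (2 * m + (N * (2 * m + 1) + (1 + n * m))).

Lemma advice_sample (i : 'I_N) r : r < 2 * m + 1 ->
  nth false advice (2 * m + (i * (2 * m + 1) + r)) =
  if r == 0 then true else if r <= m then bit H i r.-1 else bit U i (r.-1 - m).
Proof.
move=> rm; have lt : i * (2 * m + 1) + r < N * (2 * m + 1).
  apply: (@leq_trans (i.+1 * (2 * m + 1))); first by rewrite mulSn; lia.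
  by rewrite leq_mul2r ltn_ord orbT.
rewrite nth_mkseq; last by lia.
rewrite /advice_entry ltnNge leq_addr /= addKn lt.
by rewrite divnMDl ?addn1 // -addn1 divn_small // addn0 modnMDl modn_small.
Qed.

Lemma advice_stop : nth false advice (2 * m + N * (2 * m + 1)) = false.
Proof.
rewrite nth_mkseq; last by lia.
by rewrite /advice_entry ltnNge leq_addr /= addKn ltnn eqxx.
Qed.

Lemma advice_inverse (j : 'I_n) (p : 'I_m) :
  nth false advice (2 * m + (N * (2 * m + 1) + (1 + (j * m + p)))) = L j p.
Proof.
have m0 : 0 < m by case: m p => // -[].
have lt : j * m + p < n * m.
  apply: (@leq_trans (j.+1 * m)); first by rewrite mulSn; have := ltn_ord p; lia.
  by rewrite leq_mul2r ltn_ord orbT.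
rewrite nth_mkseq; last by lia.
rewrite /advice_entry ltnNge leq_addr /= addKn ltnNge leq_addr /=.
rewrite ifF; last by lia.
rewrite addKn addKn divnMDl // divn_small // addn0 modnMDl modn_small //.
exact: bitE.
Qed.

(** This and the next two definitions are what [hits], [votes] and [corrected] yield once the memory
    holds the advice. *)
Definition parity_check (w : 'cV['F_2]_m) i : bool :=
  odd (\sum_(p < m) (H i p && (w p 0 != 0)%R)).

Definition ballots (w : 'cV['F_2]_m) o p := \sum_(i < N) ((parity_check w i == o) && U i p).

Definition corrected_bit (w : 'cV['F_2]_m) p : bool :=
  if ballots w true p <= ballots w false p then (w p 0 != 0)%R else (w p 0 == 0)%R.

End Advice.

(** * Positions of the word and the advice in memory *)

Section Memory.
Variables (m n : nat) (C : 'M['F_2]_(m, n)) (w : 'cV['F_2]_m) (a : seq bool).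

Let size_C : size [seq C i j != 0%R | i <- enum 'I_m, j <- enum 'I_n] = n * m.
Proof. by rewrite size_allpairs -!cardE !card_ord mulnC. Qed.

Lemma input_word (p : 'I_m) : nth false (input_bits C w a) (n * m + p) = (w p 0 != 0)%R.
Proof.
rewrite /input_bits nth_cat size_C ltnNge leq_addr /= addKn.
rewrite nth_cat size_map -cardE card_ord ltn_ord (nth_map p) ?nth_ord_enum //.
by rewrite -cardE card_ord.
Qed.

Lemma input_advice x : nth false (input_bits C w a) ((n + 1) * m + x) = nth false a x.
Proof.
rewrite /input_bits mulnDl mul1n -addnA nth_cat size_C ltnNge leq_addr /= addKn.
by rewrite nth_cat size_map -cardE card_ord ltnNge leq_addr /= addKn.
Qed.

End Memory.

Lemma decoder_advice m n N (H U : 'I_N -> 'I_m -> bool) (L : 'I_n -> 'I_m -> bool)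
    (C : 'M['F_2]_(m, n)) (w : 'cV['F_2]_m) : 0 < n -> 0 < m ->
  exists t, [/\ t <= 100 * ((n + N) * m),
    halted decoder (run decoder t (init C w (advice H U L))) &
    forall j : 'I_n, memory (run decoder t (init C w (advice H U L))) j =
      odd (\sum_(p < m) (L j p && corrected_bit H U w p))].
Proof.
move=> n0 m0; set a := advice H U L.
pose h x : nat := nth false (input_bits C w a) x.
have ha x : h ((n + 1) * m + x) = nth false a x by rewrite /h input_advice.
have hw (p : 'I_m) : h (n * m + p) = (w p 0 != 0)%R by rewrite /h input_word.
have hQ x : h ((n + 3) * m + x) = nth false a (2 * m + x).
  by rewrite -ha; congr h; lia.
have hH (i : 'I_N) (p : 'I_m) : h ((n + 3) * m + i * (2 * m + 1) + 1 + p) = H i p.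
  have pm := ltn_ord p.
  rewrite (_ : _ + p = (n + 3) * m + (i * (2 * m + 1) + (1 + p))) ?hQ /a
    ?advice_sample; try lia.
    by rewrite add1n /= pm bitE.
have hU (i : 'I_N) (p : 'I_m) : h ((n + 3) * m + i * (2 * m + 1) + 1 + m + p) = U i p.
  have pm := ltn_ord p.
  rewrite (_ : _ + p = (n + 3) * m + (i * (2 * m + 1) + (1 + (m + p)))) ?hQ /a
    ?advice_sample; try lia.
  by rewrite add1n /= ltnNge leq_addr /= addKn bitE.
have hL (j : 'I_n) (p : 'I_m) :
    h ((n + 3) * m + N * (2 * m + 1) + 1 + j * m + p) = L j p.
  rewrite (_ : _ + p = (n + 3) * m + (N * (2 * m + 1) + (1 + (j * m + p)))); last by lia.
  by rewrite hQ /a advice_inverse.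
(* The advice starts with [2 * m] zeros, so both tallies start at 0. *)
have hz x : x < 2 * m -> h ((n + 1) * m + x) = 0.
  by move=> xm; rewrite ha /a /advice nth_mkseq ?/advice_entry ?xm //; lia.
have [||t [s [tk <- hs out]]] := @decoder_run n m N (size a) h n0 m0.
- move=> j jN; have K0 : 0 < 2 * m + 1 by lia.
  have := advice_sample H U L (Ordinal jN) K0; rewrite addn0 => E.
  by rewrite hQ (E : nth false a (2 * m + j * (2 * m + 1)) = true).
- by rewrite hQ /a advice_stop.
have votesE o (p : 'I_m) : votes m h o ((n + 3) * m) (n * m) p N = ballots H U w o p.
  apply: eq_bigr => i _; rewrite hU lt0b /parity_check /hits.
  by under [X in odd X]eq_bigr => q _ do rewrite hH hw !lt0b.
exists t; split=> // j; rewrite out //; congr (nat_of_bool (odd _)).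
apply: eq_bigr => p _; rewrite hL lt0b; congr (nat_of_bool (_ && _)).
rewrite /corrected !votesE hw.
rewrite (_ : (n + 2) * m + p = (n + 1) * m + (m + p)); last by lia.
have pm := ltn_ord p; rewrite !hz; try lia.
rewrite !add0n /corrected_bit; case: ifP => _; first by rewrite lt0b.
by rewrite lt0b eqb0 negbK.
Qed.

(** Inputs violating the promise are timed too. Memory past the input reads 0, so the first mark
    already stops the sampling loop. *)
Lemma decoder_no_advice m n (C : 'M['F_2]_(m, n)) (w : 'cV['F_2]_m) :
    0 < n -> 0 < m ->
  exists2 t, t <= 100 * (n * m) & halted decoder (run decoder t (init C w [::])).
Proof.
move=> n0 m0.
pose h x : nat := nth false (input_bits C w [::]) x.
have [//||t [s [tk <- hs _]]] := @decoder_run n m 0 0 h n0 m0.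
  by rewrite (_ : _ + _ = (n + 1) * m + 2 * m) /h ?input_advice ?nth_nil //; lia.
by exists t; rewrite // -[n]addn0.
Qed.

(** * Decoding *)

Local Open Scope ring_scope.

Lemma F2_sum_neq0 (I : finType) (F : I -> 'F_2) :
  (\sum_i F i != 0) = odd (\sum_i (F i != 0)%R).
Proof.
elim/big_rec2: _ => [|i a b _ IH]; first by rewrite eqxx.
rewrite oddD -IH oddb.
by case: (F2_cases (F i)) => ->; case: (F2_cases a) => ->.
Qed.

Lemma nearest_exists m n (C : 'M['F_2]_(m, n)) (w : 'cV['F_2]_m) :
  exists x, nearest C w x /\ (wt (C *m x + w)%R <= dist (code C) w)%N.
Proof.
pose x := [arg min_(x < (0 : 'cV['F_2]_n)) wt (C *m x + w)].
have xP : nearest C w x.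
  by move=> y; rewrite /x; case: arg_minnP => // z _; apply.
exists x; split=> //; rewrite /dist.
apply: (big_ind (fun d => wt (C *m x + w) <= d)%N).
(* The default [m] of the minimum bounds every weight. *)
- by rewrite /wt; apply: leq_trans (max_card _) _; rewrite card_ord.
- by move=> a b xa xb; rewrite leq_min xa xb.
- by move=> v /imsetP[y _ ->]; apply: xP.
Qed.

(** Checks in [dual] vanish on [C *m x], so their parities on [w] are those on the error. The sum of
    signals is the sign of the error bit times the lead of the votes for 0; if positive, the
    majority is right. *)
Lemma corrected_bit_code (R : realType) m n t N (C : 'M['F_2]_(m, n))
    (F : 'I_N -> {ffun 'I_t -> 'I_m}) (w : 'cV['F_2]_m) (x : 'cV['F_2]_n) (p : 'I_m) :
    (forall i, F i \in dual t C) ->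
    0 < \sum_i signal R (C *m x + w) p (F i) ->
  corrected_bit (fun i => odd_visits (F i)) (fun i p => once p (F i)) w p =
  ((C *m x) p 0 != 0).
Proof.
set H := fun i => odd_visits (F i); set U := fun i p => once p (F i).
move=> FD; set e := C *m x + w.
have -> : \sum_i signal R e p (F i) =
    chi R (e p 0) * ((ballots H U w false p)%:R - (ballots H U w true p)%:R).
  rewrite /ballots !natr_sum -sumrB mulr_sumr; apply: eq_bigr => i _.
  rewrite /signal /e walkD walk_dual // mul1r walk_odd_visits.
  rewrite -/(H i) -/(parity_check H w i) -/(U i p).
  by case: (parity_check H w i); case: (U i p) => /=; ring.
have -> : (C *m x) p 0 = w p 0 + e p 0.
  rewrite /e [(_ + w) p 0]mxE; case: (F2_cases ((C *m x) p 0)) => ->;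
  by case: (F2_cases (w p 0)) => ->; apply: val_inj.
rewrite /corrected_bit; case: (F2_cases (e p 0)) => ->.
  by rewrite chi0 mul1r addr0 subr_gt0 ltr_nat => /ltnW ->.
rewrite chi1 mulN1r opprB subr_gt0 ltr_nat => lt; rewrite leqNgt lt /=.
by case: (F2_cases (w p 0)) => ->.
Qed.

Lemma left_inverse_output m n (C : 'M['F_2]_(m, n)) (x : 'cV['F_2]_n) (j : 'I_n) :
    generator_matrix C ->
  odd (\sum_(p < m) ((pinvmx C j p != 0)%R && ((C *m x) p 0 != 0)%R)) = (x j 0 != 0).
Proof.
move=> genC; have full : row_full C by rewrite /row_full genC.
rewrite -[in RHS](mul1mx x) -(mulVpmx full) -mulmxA mxE F2_sum_neq0.
by congr odd; apply: eq_bigr => p _; rewrite mulf_eq0 negb_or.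
Qed.

Theorem theorem3p2 (R : realType) :
  exists (P : program) (c K : R),
  forall (n m : nat) (beta eta : R),
    (0 < n)%N -> (n < m)%N ->
    1 / m%:R <= beta < 1 / 8 -> 1 / m%:R <= eta < 1 / 8 ->
    exists adv : advice_function m n,
      [/\ solves_BNCP beta eta adv P,
          advice_size_le adv (bound c n m beta eta)
        & running_time_le adv P (K * bound c n m beta eta)].
Proof.
exists decoder, 640, 100 => n m beta eta n0 nm bI eI.
have m0 : (0 < m)%N by apply: ltn_trans nm.
have [k [kl lk]] := walk_length_exists n0 nm bI eI.
have g0 := gap_gt0 n0 nm bI eI (ltn0Sn k.+1).
have y0 : 0 <= 8 * m%:R / gap m eta k.+2 ^+ 2.
  by apply: divr_ge0; [exact: mulr_ge0|rewrite exprn_ge0 ?ltW].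
have /andP[] := truncn_itv y0; set N := (Num.truncn _).+1 => N1 /ltW hN.
have len := advice_length_le n0 nm bI eI (_ : N%:R <= _).
have {}len := len ltac:(by rewrite -[N%:R]nat1r lerD2l;
                           apply: le_trans N1 (sample_count_le n0 nm bI eI kl lk)).
(* For an unbalanced code the advice is empty, and only size and time matter. *)
pose good (C : 'M['F_2]_(m, n)) (a : seq bool) := generator_matrix C ->
  (exists F : {ffun 'I_N -> {ffun 'I_k.+2 -> 'I_m}},
      [/\ forall i, F i \in dual k.+2 C,
          forall e j, (wt e)%:R < eta * m%:R -> 0 < \sum_i signal R e j (F i) &
          a = advice (fun i => odd_visits (F i)) (fun i p => once p (F i))
                (fun j p => pinvmx C j p != 0)]) \/
  ~ balanced_code beta (code C) /\ a = [::].
have [C|adv advP] := @choice _ _ good.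
  case: (pselect (balanced_code beta (code C))) => [bal|nbal]; last first.
    by exists [::] => _; right.
  case: (pselect (generator_matrix C)) => [gen|ngen]; last by exists [::].
  have [F [FD Fpos]] := samples_exist n0 nm bI eI kl hN gen bal.
  exists (advice (fun i => odd_visits (F i)) (fun i p => once p (F i))
                (fun j p => pinvmx C j p != 0)) => _.
  by left; exists F.
exists adv; split.
- move=> C w gen [bal dst]; have [[F [FD Fpos ->]]|[/(_ bal)//]] := advP C gen.
  have [t [_ ht out]] := decoder_advice (fun i => odd_visits (F i))
    (fun i p => once p (F i)) (fun j p => pinvmx C j p != 0) C w n0 m0.
  (* The error of a nearest codeword has weight below [eta * m], so all its bits are decided
     correctly. *)
  have [x [xP xd]] := nearest_exists C w.
  exists t, x; split=> // j; rewrite out -(left_inverse_output x j gen).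
  congr (nat_of_bool (odd _)); apply: eq_bigr => p _; congr (nat_of_bool (_ && _)).
  apply: corrected_bit_code (FD) _; apply: Fpos.
  by apply: le_lt_trans dst; rewrite ler_nat.
- move=> C gen; have [[F [_ _ ->]]|[_ ->]] := advP C gen.
    by rewrite size_mkseq.
  by apply: le_trans len.
(* [(n + N) * m] is at most the length of the advice, so the time inherits its bound up to the
   factor 100. *)
- move=> C w gen; have bnd (t : nat) : (t <= 100 * ((n + N) * m))%N ->
      t%:R <= 100 * bound 640 n m beta eta.
    move=> tN; apply: (@le_trans _ _ (100 * ((n + N) * m)%:R)).
      by rewrite -natrM ler_nat.
    by apply: ler_wpM2l => //; apply: le_trans len; rewrite ler_nat mulnDl; lia.
  have [[F [_ _ ->]]|[_ ->]] := advP C gen.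
    have [t [tN ht _]] := decoder_advice (fun i => odd_visits (F i))
      (fun i p => once p (F i)) (fun j p => pinvmx C j p != 0) C w n0 m0.
    by exists t; split=> //; apply: bnd.
  have [t tN ht] := decoder_no_advice C w n0 m0.
  exists t; split=> //; apply: bnd; apply: leq_trans tN _.
  by rewrite leq_mul2l leq_mul2r leq_addr !orbT.
Qed.
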